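(* Let $Z=\{z_0,\dots,z_{n-1}\}$ be a finite metric space, let $X=\{z_0,\dots,z_{\ell-1}\}\subseteq Z$ with $1\le\ell\le n$, and let $f\colon V=\mathrm{PH}_0(X)\to U=\mathrm{PH}_0(Z)$ be the persistence morphism induced by the inclusion. Let $s\ge 0$ and suppose that $\mathcal{M}_X^Z(a,b)=0$ for all $a,b>0$ with $|b-a|>s$. Then for any $r\ge 0$ and any $[z_i]\in\pi_0(\mathrm{VR}_r(X))$ such that $\rho^V_{r(r+s)}([z_i])=[z_i]$, we have $f_r([z_i])=[z_i]$. In particular, if $s=0$, then $f_r([z_i])=[z_i]$ for all $[z_i]\in\pi_0(\mathrm{VR}_r(X))$ and all $r\ge 0$.
   Context: For a finite metric space $M$ with metric $d$ and $r\ge 0$, $\mathrm{VR}_r(M)$ is the graph with vertex set $M$ and an edge between distinct $x,y\in M$ whenever $d(x,y)\le r$; $X$ carries the metric restricted from $Z$. $H_0(\mathrm{VR}_r(M))$ is the $\mathbb{Z}_2$-vector space freely generated by the set $\pi_0(\mathrm{VR}_r(M))$ of connected components. Representative convention: an element of $\pi_0(\mathrm{VR}_r(X))$ or $\pi_0(\mathrm{VR}_r(Z))$ is always written $[z_j]$ where $z_j$ is the point of smallest index in that component. Thus $\rho^V_{r(r+s)}([z_i])=[z_i]$ means that $z_i$ is still the smallest-index point of its component in $\mathrm{VR}_{r+s}(X)$, and $f_r([z_i])=[z_i]$ means that $z_i$ is the smallest-index point of its component in $\mathrm{VR}_r(Z)$. $V=\mathrm{PH}_0(X)$ and $U=\mathrm{PH}_0(Z)$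 are the persistence modules $V_r=H_0(\mathrm{VR}_r(X))$, $U_r=H_0(\mathrm{VR}_r(Z))$, $r\ge0$, with structure maps $\rho^V_{rs},\rho^U_{rs}$ ($r\le s$) induced by the inclusions of graphs; $f_r\colon V_r\to U_r$ is induced by $\mathrm{VR}_r(X)\hookrightarrow\mathrm{VR}_r(Z)$. For $b>0$ put $\ker_b^-(U)=\bigcup_{0\le r<b}\ker(\rho^U_{0r})$ and $\ker_b^+(U)=\ker(\rho^U_{0b})$, subspaces of $U_0$; define $\ker_a^\pm(V)\subseteq V_0$ in the same way. Since $X\subseteq Z$, we view $V_0\subseteq U_0$. The induced block function is, for $a,b>0$, $$\mathcal{M}_X^Z(a,b)=\dim\left(\frac{\ker_a^+(V)\cap\ker_b^+(U)}{\ker_a^-(V)\cap\ker_b^+(U)+\ker_a^+(V)\cap\ker_b^-(U)}\right).$$ *)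

(* Defs.v *)
From HB Require Import structures.
From mathcomp Require Import all_boot all_order all_algebra.
From mathcomp Require Import boolp reals metric_structure.

Set Implicit Arguments.
Unset Strict Implicit.
Unset Printing Implicit Defensive.

Import Order.TTheory GRing.Theory Num.Theory.
Local Open Scope ring_scope.

Definition pi0 (T : finType) (e : rel T) : Type :=
  {C : {set T} | C \in equivalence_partition (connect e) [set: T]}.

Definition component (T : finType) (e : rel T) (x : T) : pi0 e :=
  exist _ [set y in [set: T] | connect e x y] (imset_f _ (in_setT x)).

Lemma mem_component (T : finType) (e : rel T) (x y : T) :
  (y \in val (component e x)) = connect e x y.
Proof. by rewrite !inE. Qed.

Lemma pi0_inhabited (T : finType) (e : rel T) (C : pi0 e) :
  exists x, x \in val C.
Proof. by case: C => C /= /imsetP[x _ ->]; exists x; rewrite !inE connect0. Qed.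

Lemma component_eq (T : finType) (e : rel T) (C : pi0 e) (x : T) :
  symmetric e -> x \in val C -> component e x = C.
Proof.
move=> /sym_connect_sym sym_e; case: C => C Cp /= xC; apply: val_inj => /=.
move: Cp xC => /imsetP[y _ ->]; rewrite !inE /= => yx.
by apply/setP => z; rewrite !inE /= (same_connect sym_e yx).
Qed.

(* Sends the component of [x] to the component of [h x]. The chosen point is
   irrelevant when [h] preserves adjacency, see [pi0_map_component]. *)
Definition pi0_map (T T' : finType) (e : rel T) (e' : rel T') (h : T -> T')
  (C : pi0 e) : pi0 e' := component e' (h (xchoose (pi0_inhabited C))).

Lemma pi0_map_component (T T' : finType) (e : rel T) (e' : rel T')
    (h : T -> T') (x : T) :
    symmetric e' -> {homo h : y z / e y z >-> e' y z} ->
  pi0_map e' h (component e x) = component e' (h x).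
Proof.
move=> sym_e' hom; apply: component_eq => //.
have := xchooseP (pi0_inhabited (component e x)).
set y := xchoose _; rewrite !mem_component => /connectP[s es ->].
apply/connectP; exists (map h s); last by rewrite last_map.
by rewrite (homo_path _ es).
Qed.

Definition H0 (T : finType) (e : rel T) := {ffun pi0 e -> ('F_2)^o}.

Definition h0_class (T : finType) (e : rel T) (C : pi0 e) : H0 e :=
  [ffun D => (D == C)%:R].

Definition H0_fun (T T' : finType) (e : rel T) (e' : rel T') (h : T -> T')
  (v : H0 e) : H0 e' := [ffun D => \sum_(C | pi0_map e' h C == D) v C].

Lemma H0_fun_linear (T T' : finType) (e : rel T) (e' : rel T') (h : T -> T') :
  linear (@H0_fun T T' e e' h).
Proof.
move=> k u v; apply/ffunP => D; rewrite !ffunE scaler_sumr -big_split /=.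
by apply: eq_bigr => C _; rewrite !ffunE.
Qed.

HB.instance Definition _ (T T' : finType) (e : rel T) (e' : rel T')
    (h : T -> T') :=
  GRing.isLinear.Build 'F_2 (H0 e) (H0 e') *:%R (@H0_fun T T' e e' h)
    (@H0_fun_linear T T' e e' h).

Definition H0_map (T T' : finType) (e : rel T) (e' : rel T') (h : T -> T') :
  'Hom(H0 e, H0 e') := linfun (@H0_fun T T' e e' h).

Lemma H0_map_class (T T' : finType) (e : rel T) (e' : rel T') (h : T -> T')
    (C : pi0 e) :
  H0_map e e' h (h0_class C) = h0_class (pi0_map e' h C).
Proof.
rewrite lfunE; apply/ffunP => D; rewrite !ffunE big_mkcond (bigD1 C) //=.
rewrite ffunE eqxx big1 => [|C' /negPf C'C]; last first.
  by rewrite ffunE C'C; case: ifP.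
by rewrite addr0 eq_sym; case: eqP.
Qed.

(* [v] is the class written [z_i]: the index [i] is the smallest one in its
   component and [v] is the basis vector of that component. *)
Definition written n (e : rel 'I_n) (v : H0 e) (i : 'I_n) : Prop :=
  (forall j : 'I_n, j \in val (component e i) -> (i <= j)%N) /\
  v = h0_class (component e i).

Section VietorisRips.
Variables (R : realType) (Z : metricType R).

(* A finite subspace is given by an injective enumeration [p] of its points,
   and the vertices are the indices of the points. *)
Definition VR n (p : 'I_n -> Z) (r : R) : rel 'I_n :=
  fun i j => (i != j) && (mdist (p i) (p j) <= r).

Definition PH0 n (p : 'I_n -> Z) (r : R) := H0 (VR p r).

Definition PH0_rho n (p : 'I_n -> Z) (r s : R) : 'Hom(PH0 p r, PH0 p s) :=
  H0_map (VR p r) (VR p s) id.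

Definition initial l n (hl : (l <= n)%N) (z : 'I_n -> Z) : 'I_l -> Z :=
  fun i => z (widen_ord hl i).

Definition PH0_incl l n (hl : (l <= n)%N) (z : 'I_n -> Z) (r : R) :
    'Hom(PH0 (initial hl z) r, PH0 z r) :=
  H0_map (VR (initial hl z) r) (VR z r) (widen_ord hl).

Definition ker_plus n (p : 'I_n -> Z) (b : R) : {vspace PH0 p 0} :=
  lker (PH0_rho p 0 b).

Definition in_ker_minus n (p : 'I_n -> Z) (b : R) (v : PH0 p 0) : Prop :=
  exists2 r : R, 0 <= r < b & v \in lker (PH0_rho p 0 r).

(* The span of the union of the kernels; by [ker_minusP] it is the union. *)
Definition ker_minus n (p : 'I_n -> Z) (b : R) : {vspace PH0 p 0} :=
  <<[seq v <- enum {: PH0 p 0} | `[< in_ker_minus b v >]]>>%VS.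

Lemma VR_sym n (p : 'I_n -> Z) (r : R) : symmetric (VR p r).
Proof. by move=> i j; rewrite /VR eq_sym metric_sym. Qed.

Lemma VR_mono n (p : 'I_n -> Z) (r s : R) :
  r <= s -> {homo (@id 'I_n) : i j / VR p r i j >-> VR p s i j}.
Proof. by move=> rs i j /andP[ij dij]; rewrite /VR ij (le_trans dij rs). Qed.

Lemma PH0_rho_comp n (p : 'I_n -> Z) (r s t : R) (v : PH0 p r) :
  r <= s -> s <= t -> PH0_rho p s t (PH0_rho p r s v) = PH0_rho p r t v.
Proof.
move=> rs st; rewrite !lfunE; apply/ffunP => D; rewrite !ffunE.
have mapK (C : pi0 (VR p r)) : pi0_map (VR p t) id (pi0_map (VR p s) id C)
              = pi0_map (VR p t) id C.
  have [i iC] := pi0_inhabited C.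
  rewrite -(component_eq (@VR_sym _ _ _) iC).
  by rewrite !pi0_map_component //; first [exact: VR_sym
    | apply: VR_mono; rewrite ?(le_trans rs)].
under eq_bigr do rewrite ffunE.
rewrite [RHS](partition_big (pi0_map (VR p s) id)
  (fun D' => pi0_map (VR p t) id D' == D)) /=; last first.
  by move=> C; rewrite mapK.
apply: eq_bigr => D' /eqP D'D; apply: eq_bigl => C.
by case: eqP => [CD'|]; rewrite ?andbF // andbT -mapK CD' D'D eqxx.
Qed.

Lemma ker_plus_mono n (p : 'I_n -> Z) (r s : R) :
  0 <= r -> r <= s -> (ker_plus p r <= ker_plus p s)%VS.
Proof.
move=> r0 rs; apply/subvP => v; rewrite !memv_ker => /eqP v0.
by rewrite -(PH0_rho_comp _ r0 rs) v0 linear0.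
Qed.

Lemma ker_minusP n (p : 'I_n -> Z) (b : R) (v : PH0 p 0) : 0 < b ->
  v \in ker_minus p b <-> in_ker_minus b v.
Proof.
move=> b0; pose P := @in_ker_minus n p b; split=> [|vP]; last first.
  apply: memv_span; rewrite mem_filter; apply/andP; split; first exact/asboolP.
  by rewrite mem_enum memvf.
rewrite /ker_minus; set X := [seq _ <- _ | _].
move/(@coord_span _ _ _ (in_tuple X)) ->; apply: (big_ind P) => [|u w|i _].
- by exists 0; rewrite ?lexx ?mem0v.
- move=> [r /andP[r0 rb] ur] [s /andP[s0 sb] ws].
  exists (Num.max r s); first by rewrite le_max r0 gt_max rb sb.
  by apply: memvD; [apply: (subvP _ _ ur)|apply: (subvP _ _ ws)];
    rewrite ker_plus_mono // le_max lexx ?orbT.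
- have : (in_tuple X)`_i \in X by apply: mem_nth.
  rewrite mem_filter => /andP[/asboolP[r rb vr] _].
  by exists r => //; apply: memvZ.
Qed.

Lemma ker_minus_sub n (p : 'I_n -> Z) (b : R) :
  0 < b -> (ker_minus p b <= ker_plus p b)%VS.
Proof.
move=> b0; apply/subvP => v /(ker_minusP _ b0)[r /andP[r0 rb]].
by apply/subvP/ker_plus_mono => //; apply: ltW.
Qed.

Section BlockFunction.
Variables (l n : nat) (hl : (l <= n)%N) (z : 'I_n -> Z).

Definition ker_plus_in (a : R) : {vspace PH0 z 0} :=
  (PH0_incl hl z 0 @: ker_plus (initial hl z) a)%VS.

Definition ker_minus_in (a : R) : {vspace PH0 z 0} :=
  (PH0_incl hl z 0 @: ker_minus (initial hl z) a)%VS.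

Definition block_num (a b : R) : {vspace PH0 z 0} :=
  (ker_plus_in a :&: ker_plus z b)%VS.

Definition block_den (a b : R) : {vspace PH0 z 0} :=
  (ker_minus_in a :&: ker_plus z b + ker_plus_in a :&: ker_minus z b)%VS.

Lemma block_den_sub (a b : R) :
  0 < a -> 0 < b -> (block_den a b <= block_num a b)%VS.
Proof.
move=> a0 b0; rewrite subv_add capvS ?limgS ?ker_minus_sub ?subvv //=.
by rewrite capvS ?ker_minus_sub ?subvv.
Qed.

(* The dimension of the quotient, in view of [block_den_sub]. *)
Definition block_fun (a b : R) : nat :=
  (\dim (block_num a b) - \dim (block_den a b))%N.

End BlockFunction.

End VietorisRips.

(* Main.v *)
(* If z_j is in the component of z_i in VR_r(Z) with j < i, then z_j lies in X
   and [z_i] + [z_j] is in V_0 and in ker_r^+(U). When all blocks with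
   |b - a| > s vanish, V_0 /\ ker_b^+(U) is contained in ker_{b+s}^+(V), so z_i
   and z_j are in the same component of VR_{r+s}(X). Hence z_i is not the
   smallest-index point of its component there. *)

Require Import Defs.
From mathcomp Require Import all_boot all_order all_algebra.
From mathcomp Require Import boolp reals metric_structure.

Set Implicit Arguments.
Unset Strict Implicit.
Unset Printing Implicit Defensive.

Import Order.TTheory GRing.Theory Num.Theory.
Local Open Scope ring_scope.

(** * Components, their classes and injectivity on homology *)

Lemma component_eqP (T : finType) (e : rel T) (x y : T) :
  symmetric e -> component e x = component e y <-> connect e x y.
Proof.
move=> sym_e; split=> [xy|xy]; first by rewrite -mem_component xy mem_component.
by apply/esym/component_eq => //; rewrite mem_component.
Qed.

Lemma h0_class_inj (T : finType) (e : rel T) : injective (@h0_class T e).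
Proof.
rewrite /h0_class => C D /ffunP/(_ C); rewrite [LHS]ffunE [RHS]ffunE eqxx.
case: eqP => [//|_ /eqP]; by rewrite oner_eq0.
Qed.

(** Each nonempty fibre on components is a single component, so the coefficient of [u] at [C] can be
    read off at the image of [C]. *)
Lemma H0_map_inj (T T' : finType) (e : rel T) (e' : rel T') (h : T -> T') :
  injective (@pi0_map T T' e e' h) -> injective (H0_map e e' h).
Proof.
move=> h_inj u v; rewrite !lfunE => /ffunP uv; apply/ffunP => C.
move: (uv (pi0_map e' h C)); rewrite !ffunE.
under eq_bigl do rewrite (inj_eq h_inj).
rewrite big_pred1_eq => ->.
under eq_bigl do rewrite (inj_eq h_inj).
by rewrite big_pred1_eq.
Qed.

Lemma lfunB (K : fieldType) (U V : vectType K) (f : 'Hom(U, V)) (u v : U) :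
  f (u - v) = f u - f v.
Proof. exact: linearB. Qed.

Lemma memv_kerB (K : fieldType) (U V : vectType K) (f : 'Hom(U, V)) (u v : U) :
  (u - v \in lker f) = (f u == f v).
Proof. by rewrite memv_ker lfunB subr_eq0. Qed.

(** * Vietoris-Rips graphs, especially at radius 0 *)

Section VietorisRips.
Variables (R : realType) (Z : metricType R).

Lemma connect_VR0 n (p : 'I_n -> Z) (i j : 'I_n) :
  injective p -> connect (VR p 0) i j -> i = j.
Proof.
move=> p_inj /connectP[[|k s] //= /andP[/andP[ik d0] _] _].
by move: ik; rewrite -(inj_eq p_inj) -mdist_gt0 ltNge d0.
Qed.

Lemma PH0_rho_class n (p : 'I_n -> Z) (r s : R) (i : 'I_n) : r <= s ->
  PH0_rho p r s (h0_class (component (VR p r) i)) =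
  h0_class (component (VR p s) i).
Proof.
move=> rs; rewrite /PH0_rho H0_map_class pi0_map_component //.
  exact: VR_sym.
exact: VR_mono.
Qed.

Lemma VR_initial l n (hl : (l <= n)%N) (z : 'I_n -> Z) (r : R) (i j : 'I_l) :
  VR z r (widen_ord hl i) (widen_ord hl j) = VR (initial hl z) r i j.
Proof. by []. Qed.

Lemma PH0_incl_class l n (hl : (l <= n)%N) (z : 'I_n -> Z) (r : R) (i : 'I_l) :
  PH0_incl hl z r (h0_class (component (VR (initial hl z) r) i)) =
  h0_class (component (VR z r) (widen_ord hl i)).
Proof.
rewrite /PH0_incl H0_map_class pi0_map_component //.
exact: VR_sym.
Qed.

(** This justifies viewing $V_0$ inside $U_0$: at radius 0 distinct points of $Z$ lie in distinct
    components. *)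
Lemma PH0_incl0_inj l n (hl : (l <= n)%N) (z : 'I_n -> Z) :
  injective z -> injective (PH0_incl hl z 0).
Proof.
move=> z_inj; apply: H0_map_inj => C D.
have [i iC] := pi0_inhabited C; have [j jD] := pi0_inhabited D.
rewrite -(component_eq (@VR_sym _ _ _ _ _) iC).
rewrite -(component_eq (@VR_sym _ _ _ _ _) jD).
rewrite !pi0_map_component //; try exact: VR_sym.
move/(component_eqP _ _ (@VR_sym _ _ _ _ _))/(connect_VR0 z_inj).
by move/(congr1 val) => /= /val_inj ->.
Qed.

Lemma ker_plus0 n (p : 'I_n -> Z) : ker_plus p 0 = 0%VS.
Proof.
apply/eqP/lker0P/H0_map_inj => C D.
have [i iC] := pi0_inhabited C; have [j jD] := pi0_inhabited D.
rewrite -(component_eq (@VR_sym _ _ _ _ _) iC).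
rewrite -(component_eq (@VR_sym _ _ _ _ _) jD).
by rewrite !pi0_map_component //; exact: VR_sym.
Qed.

Lemma eq_VR_ker_plus n (p : 'I_n -> Z) (a b : R) :
  VR p a =2 VR p b -> ker_plus p a = ker_plus p b.
Proof.
move=> eq_ab; have ab : VR p a = VR p b.
  by apply/funext => i; apply/funext => j; exact: eq_ab.
by rewrite /ker_plus /PH0_rho /PH0 ab.
Qed.

(** * Containment of kernels from vanishing blocks *)

Section Filtration.
Variables (l n : nat) (hl : (l <= n)%N) (z : 'I_n -> Z).

Definition close_pairs (a : R) : {set 'I_n * 'I_n} :=
  [set u | mdist (z u.1) (z u.2) <= a].

(* Rounding [a] down to the largest distance not above it does not change the
   Vietoris-Rips graphs. *)
Lemma critical_value (a : R) : (0 < n)%N -> 0 <= a ->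
  exists c, [/\ 0 <= c <= a, VR z c =2 VR z a
    & forall a', a' < c -> (#|close_pairs a'| < #|close_pairs a|)%N].
Proof.
move=> n0 a0; pose k := Ordinal n0; pose f (u : 'I_n * 'I_n) :=
  mdist (z u.1) (z u.2).
have kP : f (k, k) <= a by rewrite /f /= mdistxx.
pose m := [arg max_(u > (k, k) | f u <= a) f u]%O.
have [ma mmax] : f m <= a /\ forall u, f u <= a -> f u <= f m.
  by rewrite /m; case: (arg_maxP (P := fun u => f u <= a) f kP).
exists (f m); split=> [|i j|a' a'm].
- by rewrite mdist_ge0.
- rewrite /VR; congr (_ && _); apply/idP/idP => [d|/(mmax (i, j))//].
  exact: le_trans d ma.
- apply: proper_card; apply/properP; split.
    apply/subsetP => u; rewrite !inE => d.
    exact: le_trans d (le_trans (ltW a'm) ma).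
  (* The pair [m] attains the distance [c], so it is counted at [a] but at no radius below [c]. *)
  by exists m; rewrite !inE // -ltNge.
Qed.

Lemma ker_plus_in_mono (a b : R) :
  0 <= a -> a <= b -> (ker_plus_in hl z a <= ker_plus_in hl z b)%VS.
Proof. by move=> a0 ab; apply/limgS/ker_plus_mono. Qed.

(** The minus kernel is a union of kernels, so each of its vectors dies at a strictly smaller
    radius; this drives the descent below. *)
Lemma ker_minus_inP (a : R) (v : PH0 z 0) : 0 < a ->
  v \in ker_minus_in hl z a ->
  exists2 a', 0 <= a' < a & v \in ker_plus_in hl z a'.
Proof.
move=> a0 /memv_imgP[w /(ker_minusP _ a0)[r rb wr] ->].
by exists r => //; apply: memv_img.
Qed.

(** The truncated difference only bounds one dimension by the other; the inclusion of the
    denominator in the numerator then forces equality. *)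
Lemma block_fun0 (a b : R) : 0 < a -> 0 < b -> block_fun hl z a b = 0%N ->
  block_num hl z a b = block_den hl z a b.
Proof.
move=> a0 b0 /eqP; rewrite subn_eq0 => le_dim; apply/esym/eqP.
by rewrite eqEdim block_den_sub.
Qed.

(* A minimal counterexample lies in a block [(a, b)] with [b + s < a]; since
   that block vanishes, it is a sum of two vectors for which the claim holds. *)
Lemma ker_plus_in_shift (s : R) : 0 <= s ->
  (forall a b : R, 0 < a -> 0 < b -> s < `|b - a| ->
     block_fun hl z a b = 0%N) ->
  forall a b : R, 0 <= a -> 0 <= b ->
    (ker_plus_in hl z a :&: ker_plus z b <= ker_plus_in hl z (b + s))%VS.
Proof.
move=> s0 hM a b.
have [n0|] := ltnP 0 n; last first.
  rewrite leqn0 => /eqP n0 _ _; apply/subvP => v _.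
  suff -> : v = 0 by rewrite mem0v.
  apply/ffunP => C; have [i _] := pi0_inhabited C.
  by have := ltn_ord i; rewrite {2}n0.
(* Counting pairs of points within each radius turns descent in real radii into induction on a
   natural number. *)
have [N] := ubnP (#|close_pairs a| + #|close_pairs b|).
elim: N => // N IH in a b *; rewrite ltnS => abN a0 b0.
have [c [/andP[c0 ca] VRc cN]] := critical_value n0 a0.
have [d [/andP[d0 db] VRd dN]] := critical_value n0 b0.
have -> : ker_plus_in hl z a = ker_plus_in hl z c.
  rewrite /ker_plus_in (@eq_VR_ker_plus _ (initial hl z) a c) // => i j.
  by rewrite -!VR_initial VRc.
have -> : ker_plus z b = ker_plus z d by apply: eq_VR_ker_plus => // i j.
have db_s : d + s <= b + s by rewrite lerD2r.
have ds0 : 0 <= d + s by rewrite addr_ge0.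
have [cds|dsc] := leP c (d + s).
  apply: subv_trans (capvSl _ _) _.
  by apply: ker_plus_in_mono => //; apply: le_trans db_s.
(* Blocks are controlled only at positive radii; at [d = 0] the kernel in $U_0$ is zero. *)
have [d00|dn0] := eqVneq d 0; first by rewrite d00 ker_plus0 capv0 sub0v.
have dp : 0 < d by rewrite lt_neqAle eq_sym dn0.
have cp : 0 < c by apply: le_lt_trans dsc.
have cNN : (#|close_pairs c| <= #|close_pairs a|)%N.
  by apply/subset_leq_card/subsetP => u; rewrite !inE => /le_trans ->.
have dNN : (#|close_pairs d| <= #|close_pairs b|)%N.
  by apply/subset_leq_card/subsetP => u; rewrite !inE => /le_trans ->.
have := block_fun0 cp dp (hM _ _ cp dp _).
rewrite /block_num => -> //; last first.
  by rewrite distrC ltr_normr ltrBrDl dsc.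
(* The first summand lowers the radius in $X$ below [c], the second the radius in $Z$ below [d];
   either way the number of pairs drops. *)
rewrite subv_add; apply/andP; split; apply/subvP => v.
- move=> /memv_capP[/(ker_minus_inP cp)[a' /andP[a'0 a'c] va'] vd].
  apply: (subvP (ker_plus_in_mono ds0 db_s)).
  apply: (subvP (IH a' d _ a'0 d0)); last exact/memv_capP.
  apply: leq_trans abN; rewrite -addSn; exact: leq_add (cN _ a'c) dNN.
- move=> /memv_capP[vc /(ker_minusP _ dp)[b' /andP[b'0 b'd] vb']].
  have le_b' : b' + s <= b + s by rewrite lerD2r (le_trans (ltW b'd)).
  apply: (subvP (ker_plus_in_mono (addr_ge0 b'0 s0) le_b')).
  apply: (subvP (IH c b' _ c0 b'0)); last exact/memv_capP.
  apply: leq_trans abN; rewrite -addnS; exact: leq_add cNN (dN _ b'd).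
Qed.

(** The difference of two point classes dies at a radius exactly when the points are connected
    there, so the containment of kernels applies to it. *)
Lemma connect_VR_shift (s r : R) (i j : 'I_l) : injective z -> 0 <= s ->
  (forall a b : R, 0 < a -> 0 < b -> s < `|b - a| ->
     block_fun hl z a b = 0%N) ->
  0 <= r -> connect (VR z r) (widen_ord hl i) (widen_ord hl j) ->
  connect (VR (initial hl z) (r + s)) i j.
Proof.
move=> z_inj s0 hM r0 ij; pose X := initial hl z.
pose cls k : PH0 X 0 := h0_class (component (VR X 0) k).
have clsE k t : 0 <= t ->
  PH0_rho X 0 t (cls k) = h0_class (component (VR X t) k).
  exact: PH0_rho_class.
have clsZE k : PH0_rho z 0 r (PH0_incl hl z 0 (cls k)) =
    h0_class (component (VR z r) (widen_ord hl k)).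
  by rewrite (PH0_incl_class hl z 0 k); exact: PH0_rho_class.
have [->|neq_ij] := eqVneq i j; first exact: connect0.
(* At this radius an edge of $X$ joins the two points; its size is harmless, as the bound [r + s]
   does not involve [a]. *)
pose a := mdist (X i) (X j).
have : PH0_incl hl z 0 (cls i - cls j) \in ker_plus_in hl z (r + s).
  apply: (subvP (ker_plus_in_shift s0 hM (a := a) (mdist_ge0 _ _) r0)).
  apply/memv_capP; split.
    apply: memv_img.
    rewrite /ker_plus memv_kerB (clsE i) ?mdist_ge0 // (clsE j) ?mdist_ge0 //.
    apply/eqP; congr h0_class; apply/component_eqP; first exact: VR_sym.
    by apply: connect1; rewrite /VR neq_ij lexx.
  rewrite lfunB /ker_plus memv_kerB (clsZE i) (clsZE j).
  apply/eqP; congr h0_class; apply/component_eqP => //; exact: VR_sym.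
move=> /memv_imgP[w ws /(PH0_incl0_inj z_inj) ijw].
move: ws; rewrite -ijw memv_kerB (clsE i) ?addr_ge0 // (clsE j) ?addr_ge0 //.
by move=> /eqP/h0_class_inj/component_eqP; apply; exact: VR_sym.
Qed.

End Filtration.

End VietorisRips.

Theorem proposition3p4 (R : realType) (Z : metricType R) (n l : nat)
    (z : 'I_n -> Z) (hz : bijective z) (hl1 : (1 <= l)%N) (hl : (l <= n)%N)
    (s : R) (hs : 0 <= s)
    (hM : forall a b : R, 0 < a -> 0 < b -> s < `|b - a| ->
      block_fun hl z a b = 0%N) :
  (forall (r : R) (i : 'I_l) (v : PH0 (initial hl z) r), 0 <= r ->
    written v i -> written (PH0_rho (initial hl z) r (r + s) v) i ->
    written (PH0_incl hl z r v) (widen_ord hl i)) /\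
  (s = 0 ->
    forall (r : R) (i : 'I_l) (v : PH0 (initial hl z) r), 0 <= r ->
      written v i -> written (PH0_incl hl z r v) (widen_ord hl i)).
Proof.
have main (r : R) (i : 'I_l) (v : PH0 (initial hl z) r) : 0 <= r ->
    written v i ->
    (forall j, connect (VR (initial hl z) (r + s)) i j -> (i <= j)%N) ->
    written (PH0_incl hl z r v) (widen_ord hl i).
  move=> r0 [_ ->] imin; split; last exact: PH0_incl_class.
  move=> j; rewrite mem_component /= leqNgt => ij; apply/negP => lt_ji.
  have lt_jl : (j < l)%N := ltn_trans lt_ji (ltn_ord i).
  have jE : j = widen_ord hl (Ordinal lt_jl) by apply: val_inj.
  move: ij; rewrite jE => ij.
  have := imin _ (connect_VR_shift (bij_inj hz) hs hM r0 ij).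
  by rewrite leqNgt lt_ji.
split=> [r i v r0 vi [imin _]|s0 r i v r0 vi]; apply: main => // j ij.
  by apply: imin; rewrite mem_component.
(* For [s = 0] the minimality at [r + s] is already part of [written v i]. *)
by case: vi => imin _; apply: imin; rewrite mem_component -[r]addr0 -s0.
Qed.
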